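(* Let $P_1,\dots,P_L\subset\mathbb{R}^N$ be finitely many polytopes. For each $j$, let $v^{(j)}(x)$ denote a vertex of $P_j$ closest to $x$ in Euclidean norm (with some fixed tie-breaking rule) and, for $\gamma\in P_j$, let $\phi^{(j)}_\gamma(x)=x+(\gamma-v^{(j)}(x))$. Then there exists a bounded convex set $Q_\infty\subset\mathbb{R}^N$ such that for each $j\in\{1,\dots,L\}$ there is $\rho_j>0$ with $\phi^{(j)}_\gamma(\rho Q_\infty)\subset\rho Q_\infty$ for all $\gamma\in P_j$ and all $\rho\ge\rho_j$.
   Context: $\rho Q_\infty=\{\rho q: q\in Q_\infty\}$. *)

(* Defs.v *)
From HB Require Import structures.
From mathcomp Require Import all_boot all_order all_algebra.
From mathcomp Require Import classical_sets reals.
Set Implicit Arguments. Unset Strict Implicit. Unset Printing Implicit Defensive.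
Import Order.TTheory GRing.Theory Num.Theory.
Local Open Scope classical_set_scope.
Local Open Scope ring_scope.

Section Defs.
Variables (R : realType) (N : nat).
Implicit Types (A : set 'rV[R]_N) (x y : 'rV[R]_N).

Definition sqdist x y : R := \sum_(i < N) (x ord0 i - y ord0 i) ^+ 2.

Definition conv_hull (S : seq 'rV[R]_N) : set 'rV[R]_N :=
  [set x | exists w : 'I_(size S) -> R,
     (forall i, 0 <= w i) /\ \sum_i w i = 1 /\
     x = \sum_i w i *: S`_i].

Definition is_polytope A := exists S : seq 'rV[R]_N, A = conv_hull S.

Definition is_vertex A x := A x /\
  forall y z (t : R), A y -> A z -> 0 < t < 1 ->
    x = t *: y + (1 - t) *: z -> y = z.

Definition closest_vertex A x v :=
  is_vertex A v /\ forall w, is_vertex A w -> sqdist x v <= sqdist x w.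

Definition convex_set A := forall x y (t : R), A x -> A y -> 0 <= t <= 1 ->
  A (t *: x + (1 - t) *: y).

Definition bounded_set A := exists M : R, forall x, A x -> sqdist x 0 <= M.

Definition scale_set (rho : R) A : set 'rV[R]_N := [set rho *: q | q in A].

End Defs.

(* Main.v *)
Require Import Defs.
From mathcomp Require Import all_boot all_order all_algebra.
From mathcomp Require Import boolp classical_sets reals.
From mathcomp Require Import ring lra.
Set Implicit Arguments. Unset Strict Implicit. Unset Printing Implicit Defensive.
Import Order.TTheory GRing.Theory Num.Theory.
Local Open Scope classical_set_scope.
Local Open Scope ring_scope.

(** Let [D] collect all differences of vertices of the polytopes. The set is
    cut out by the constraints [|proj S x|^2 <= b^(#|D|+1) - b^#|S|], for all
    duplicate-free lists [S] from [D], where [proj S] is the orthogonal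
    projection onto the complement of [S] and [b] is large. By convexity it is
    enough to move [q = x / rho] by [eps d], where [eps = 1 / rho] and
    [d = w - v] for a vertex [w]; that [v] is closest to [x] gives
    [<q, d> <= O(eps)]. If [d] is orthogonal to the range of [proj S], the move
    does not affect the constraint of [S]. Otherwise, when that constraint is
    almost active at [q], the ones of [d :: S] and of the empty list force
    [<proj S q, d> <= -1], and this first-order decrease absorbs the
    second-order term [eps^2 |proj S d|^2]. A ball would not do: it leaves no
    room for the second-order term when [<q, d> = 0]. *)

(** * Euclidean inner product and Gram-Schmidt projections *)

Section Projection.
Variables (R : realFieldType) (N : nat).
Implicit Types (x y d : 'rV[R]_N) (S : seq 'rV[R]_N).

Definition dot x y : R := \sum_(i < N) x ord0 i * y ord0 i.

Lemma dotC x y : dot x y = dot y x.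
Proof. by apply: eq_bigr => i _; rewrite mulrC. Qed.

Lemma dotDl x y z : dot (x + y) z = dot x z + dot y z.
Proof. by rewrite -big_split; apply: eq_bigr => i _; rewrite mxE mulrDl. Qed.

Lemma dotZl (a : R) x y : dot (a *: x) y = a * dot x y.
Proof. by rewrite mulr_sumr; apply: eq_bigr => i _; rewrite mxE mulrA. Qed.

Lemma dotNl x y : dot (- x) y = - dot x y.
Proof. by rewrite -scaleN1r dotZl mulN1r. Qed.

Lemma dot0l x : dot 0 x = 0.
Proof. by rewrite -(scale0r 0) dotZl mul0r. Qed.

Lemma dotDr x y z : dot x (y + z) = dot x y + dot x z.
Proof. by rewrite !(dotC x) dotDl. Qed.

Lemma dotZr (a : R) x y : dot x (a *: y) = a * dot x y.
Proof. by rewrite !(dotC x) dotZl. Qed.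

Lemma dotNr x y : dot x (- y) = - dot x y.
Proof. by rewrite !(dotC x) dotNl. Qed.

Definition dotE := (dotDl, dotDr, dotNl, dotNr, dotZl, dotZr).

Lemma dot_ge0 x : 0 <= dot x x.
Proof. by apply: sumr_ge0 => i _; rewrite -expr2 sqr_ge0. Qed.

Lemma dot_eq0 x : dot x x = 0 -> x = 0.
Proof.
move/eqP; rewrite psumr_eq0 => [/allP x0|i _]; last by rewrite -expr2 sqr_ge0.
apply/rowP => i; rewrite mxE; apply/eqP.
by have := x0 i (mem_index_enum i); rewrite mulf_eq0 orbb.
Qed.

Lemma dot_gt0 x : x != 0 -> 0 < dot x x.
Proof.
by move=> x0; rewrite lt_def dot_ge0 andbT; apply: contra_neq x0 => /dot_eq0.
Qed.

Lemma ler_dot2 x y : 2 * dot x y <= dot x x + dot y y.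
Proof. by have := dot_ge0 (x - y); rewrite !dotE (dotC y x); lra. Qed.

Lemma cauchy_schwarz x y : dot x y ^+ 2 <= dot x x * dot y y.
Proof.
have [->|y0] := eqVneq y 0; first by rewrite dotC !dot0l expr0n mulr0.
have yy := dot_gt0 y0.
have := dot_ge0 (dot y y *: x - dot x y *: y); rewrite !dotE (dotC y x).
rewrite (_ : _ + _ = dot y y * (dot x x * dot y y - dot x y ^+ 2)); last by ring.
by rewrite pmulr_rge0 // subr_ge0.
Qed.

(* Orthogonal projection onto the orthogonal complement of [S], by
   Gram-Schmidt; when [proj S d = 0] the correction term vanishes since
   [x / 0 = 0]. *)
Fixpoint proj S x : 'rV[R]_N :=
  if S is d :: S' then
    let g := proj S' d in proj S' x - (dot (proj S' x) d / dot g g) *: g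
  else x.

Lemma projP S (a : R) x y : proj S (a *: x + y) = a *: proj S x + proj S y.
Proof.
elim: S a x y => [//|d S IH] a x y /=; rewrite !IH !dotE.
rewrite scalerBr addrACA -opprD; congr (_ - _).
by rewrite scalerA -scalerDl mulrDl mulrA.
Qed.

Lemma projD S x y : proj S (x + y) = proj S x + proj S y.
Proof. by rewrite -[x in LHS]scale1r projP scale1r. Qed.

Lemma proj0 S : proj S 0 = 0.
Proof. by apply: (addrI (proj S 0)); rewrite -projD !addr0. Qed.

Lemma projZ S (a : R) x : proj S (a *: x) = a *: proj S x.
Proof. by rewrite -[_ *: x]addr0 projP proj0 addr0. Qed.

Lemma proj_sym S x y : dot (proj S x) y = dot x (proj S y).
Proof.
elim: S x y => [//|d S IH] x y /=.
by rewrite !dotE IH (dotC (proj S y) d) -!IH; ring.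
Qed.

Lemma proj_idem S x : proj S (proj S x) = proj S x.
Proof.
elim: S x => [//|d S IH] x /=; set g := proj S d.
have [g0|g0] := eqVneq g 0; first by rewrite !g0 !scaler0 !subr0.
have gd : dot g d = dot g g by rewrite /g -[in LHS]IH proj_sym.
have gg : dot g g != 0 by rewrite gt_eqF ?dot_gt0.
rewrite -scaleNr projD projZ IH [proj S g]IH -/g.
by rewrite dotDl dotZl gd mulNr divfK // subrr mul0r scale0r subr0.
Qed.

Lemma dot_proj S x : dot (proj S x) (proj S x) = dot (proj S x) x.
Proof. by rewrite -proj_sym proj_idem. Qed.

Lemma dot_subproj S x :
  dot (x - proj S x) (x - proj S x) = dot x x - dot (proj S x) (proj S x).
Proof. by rewrite !dotE (dotC x) -dot_proj; ring. Qed.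

Lemma dot_proj_le S x : dot (proj S x) (proj S x) <= dot x x.
Proof. by rewrite -subr_ge0 -dot_subproj dot_ge0. Qed.

(** Pythagoras: [proj (d :: S) x] is [proj S x] minus its component along [proj S d]. *)
Lemma dot_proj_cons S d x :
  dot (proj (d :: S) x) (proj (d :: S) x) =
  dot (proj S x) (proj S x) -
    dot (proj S x) d ^+ 2 / dot (proj S d) (proj S d).
Proof.
rewrite dot_proj /= !dotE -dot_proj; congr (_ - _).
by rewrite (proj_sym S d x) (dotC d) mulrAC expr2.
Qed.

Lemma proj_mem S d : d \in S -> proj S d = 0.
Proof.
elim: S => [//|e S IH]; rewrite inE => /predU1P[->|/IH] /=; last first.
  by move=> ->; rewrite dot0l mul0r scale0r subr0.
have [->|g0] := eqVneq (proj S e) 0; first by rewrite scaler0 subr0.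
by rewrite -dot_proj divff ?gt_eqF ?dot_gt0 // scale1r subrr.
Qed.

End Projection.

(** * Uniform bounds over finite families *)

Section FiniteBounds.
Variables (R : realDomainType) (T : eqType).

Lemma seq_bounded (D : seq T) (f : T -> R) :
  exists2 B, 0 <= B & forall x, x \in D -> f x <= B.
Proof.
exists (\sum_(x <- D) `|f x|); first exact: sumr_ge0.
elim: D => [//|y D IH] x; rewrite inE big_cons => /predU1P[->|/IH].
  by apply: (le_trans (ler_norm _)); rewrite lerDl sumr_ge0.
by move=> le_f; apply: (le_trans le_f); rewrite lerDr.
Qed.

(** Induction on the length: for each head [d] the tails give a bound [b d], and [b] is in turn
    bounded over [D]. *)
Lemma words_bounded (D : seq T) n (f : seq T -> R) :
  exists2 B, 0 <= B &
    forall S, (size S <= n)%N -> {subset S <= D} -> f S <= B.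
Proof.
elim: n f => [|n IH] f.
  by exists `|f [::]| => // S; rewrite leqn0 => /nilP -> _; exact: ler_norm.
have /choice[b hb] : forall d, exists b, forall S, (size S <= n)%N ->
    {subset S <= D} -> f (d :: S) <= b.
  by move=> d; have [b _ hb] := IH (fun S => f (d :: S)); exists b.
have [B B0 hB] := seq_bounded D b.
exists (`|f [::]| + B) => [|[|d S] /= sS sD]; first exact: addr_ge0.
  by apply: (le_trans (ler_norm _)); rewrite lerDl.
apply: (le_trans (hb d S sS _)) => [x xS|].
  by apply: sD; rewrite inE xS orbT.
apply: (le_trans (hB d _)); last by rewrite lerDr.
by apply: sD; rewrite inE eqxx.
Qed.

End FiniteBounds.

(** * Convex hulls: a polytope is the hull of its vertices *)

Section ConvexHull.
Variables (R : realType) (N : nat).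
Implicit Types (A : set 'rV[R]_N) (x y s : 'rV[R]_N) (S : seq 'rV[R]_N).

Lemma conv_hull_nil x : ~ conv_hull [::] x.
Proof.
by case=> w [_ []]; rewrite big_ord0 => /esym/eqP; rewrite oner_eq0.
Qed.

Lemma conv_hull_convex S : convex_set (conv_hull S).
Proof.
move=> _ _ t [w [w0 [w1 ->]]] [u [u0 [u1 ->]]] /andP[t0 t1].
exists (fun i => t * w i + (1 - t) * u i); split=> [i|].
  by rewrite addr_ge0 // mulr_ge0 // subr_ge0.
split; first by rewrite big_split -!mulr_sumr /= w1 u1; ring.
rewrite !scaler_sumr -big_split /=; apply: eq_bigr => i _.
by rewrite !scalerA -scalerDl.
Qed.

Lemma mem_conv_hull S s : s \in S -> conv_hull S s.
Proof.
rewrite -index_mem => sS.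
exists (fun i => (i == Ordinal sS)%:R); split=> [i|]; first exact: ler0n.
split.
  by rewrite (bigD1 (Ordinal sS)) //= eqxx big1 ?addr0 // => i /negPf ->.
rewrite (bigD1 (Ordinal sS)) //= eqxx scale1r big1 ?addr0.
  by rewrite nth_index // -index_mem.
by move=> i /negPf ->; rewrite scale0r.
Qed.

Lemma conv_hull_cons s S x : conv_hull (s :: S) x ->
  x = s \/ exists t y, [/\ 0 <= t < 1, conv_hull S y & x = t *: s + (1 - t) *: y].
Proof.
move=> [w [w0 [w1 ->]]]; move: w1; rewrite /= !big_ord_recl /= => w1.
have sum_ge0 : 0 <= \sum_(i < size S) w (lift ord0 i) by exact: sumr_ge0.
(* The remaining weights are renormalised by [1 - w ord0], so weight 1 is treated apart. *)
have [t1|t1] := eqVneq (w ord0) 1; [left|right].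
  have /eqP : \sum_(i < size S) w (lift ord0 i) = 0 by lra.
  rewrite psumr_eq0 // => /allP w00; rewrite t1 scale1r big1 ?addr0 // => i _.
  by have /eqP -> := w00 i (mem_index_enum i); rewrite scale0r.
have t_lt1 : w ord0 < 1 by rewrite lt_neqAle t1; lra.
have t_neq0 : 1 - w ord0 != 0 by rewrite subr_eq0 eq_sym.
exists (w ord0), (\sum_(i < size S) (w (lift ord0 i) / (1 - w ord0)) *: S`_i).
split; first by rewrite w0.
  exists (fun i => w (lift ord0 i) / (1 - w ord0)); split=> [i|].
    by rewrite divr_ge0 // subr_ge0 ltW.
  by split=> //; rewrite -mulr_suml (_ : \sum_i _ = 1 - w ord0) ?divff //; lra.
congr (_ + _); rewrite scaler_sumr; apply: eq_bigr => i _.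
by rewrite scalerA mulrC divfK.
Qed.

Lemma conv_hull_min A S : convex_set A -> (forall s, s \in S -> A s) ->
  conv_hull S `<=` A.
Proof.
move=> cA; elim: S => [_ x /conv_hull_nil//|s S IH] SA x.
have As : A s by apply: SA; rewrite inE eqxx.
case/conv_hull_cons=> [->//|[t [y [/andP[t0 t1] Sy ->]]]].
apply: cA => //; last by rewrite t0 ltW.
by apply: IH Sy => z zS; apply: SA; rewrite inE zS orbT.
Qed.

Lemma conv_hull_sub S S' : {subset S <= S'} -> conv_hull S `<=` conv_hull S'.
Proof.
move=> SS'; apply: conv_hull_min; first exact: conv_hull_convex.
by move=> s /SS'; exact: mem_conv_hull.
Qed.

(** Extremality refers to a fixed [A], so that it survives while the induction shrinks [S]. *)
Lemma extreme_mem A S x : (forall s, s \in S -> A s) -> convex_set A ->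
  is_vertex A x -> conv_hull S x -> x \in S.
Proof.
move=> SA cA [_ ext]; elim: S SA => [_ /conv_hull_nil//|s S IH] SA.
have As : A s by apply: SA; rewrite inE eqxx.
have {}SA z : z \in S -> A z by move=> zS; apply: SA; rewrite inE zS orbT.
rewrite inE => /conv_hull_cons[->|[t [y [/andP[t0 t1] Sy def_x]]]].
  by rewrite eqxx.
have [t00|t_neq0] := eqVneq t 0.
  by rewrite IH ?orbT // def_x t00 scale0r add0r subr0 scale1r.
have sy : s = y.
  apply: (ext s y t) => //; first exact: conv_hull_min cA SA _ Sy.
  by rewrite lt_def t_neq0 t0.
by rewrite def_x -sy -scalerDl addrC subrK scale1r eqxx.
Qed.

Lemma vertex_mem S x : is_vertex (conv_hull S) x -> x \in S.
Proof.
move=> vx; apply: (extreme_mem (A := conv_hull S)) => //; last by case: vx.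
- exact: mem_conv_hull.
- exact: conv_hull_convex.
Qed.

(** If [s] lies strictly between [y] and [z], write both as mixtures of [s] and points of the
    smaller hull, then cancel [s]. *)
Lemma irredundant_vertex S s : s \in S -> ~ conv_hull (rem s S) s ->
  is_vertex (conv_hull S) s.
Proof.
move=> sS irr; split=> [|y z t]; first exact: mem_conv_hull.
have sub : conv_hull S `<=` conv_hull (s :: rem s S).
  by apply: conv_hull_sub => x; rewrite (perm_mem (perm_to_rem sS)).
(* The alternative [a = 0] covers [x = s], where the smaller hull may be empty. *)
have decomp x : conv_hull S x -> exists a x', [/\ 0 <= a,
    a = 0 \/ conv_hull (rem s S) x' & x = (1 - a) *: s + a *: x'].
  case/sub/conv_hull_cons=> [->|[a [x' [/andP[_ a1] Tx' ->]]]].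
    by exists 0, 0; rewrite scaler0 subr0 scale1r addr0; split=> //; left.
  exists (1 - a), x'; split; [by rewrite subr_ge0 ltW|by right|].
  by rewrite subKr.
move=> /decomp[a [y' [a0 Ty' ->]]] /decomp[b [z' [b0 Tz' ->]]] /andP[t0 t1].
have t10 : 0 < 1 - t by rewrite subr_gt0.
set a' := t * a; set b' := (1 - t) * b => def_s.
have a'0 : 0 <= a' by rewrite mulr_ge0 // ltW.
have b'0 : 0 <= b' by rewrite mulr_ge0 // ltW.
have {}def_s : (a' + b') *: s = a' *: y' + b' *: z'.
  apply: (addIr ((1 - (a' + b')) *: s)).
  rewrite -scalerDl addrC subrK scale1r [LHS]def_s !scalerDr !scalerA.
  rewrite addrACA -scalerDl addrC; congr (_ + _ *: _); rewrite /a' /b'; ring.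
have [ab0|ab0] := eqVneq (a' + b') 0.
  have /eqP : a' = 0 by lra.
  have /eqP : b' = 0 by lra.
  rewrite !mulf_eq0 (gt_eqF t0) (gt_eqF t10) /= => /eqP -> /eqP ->.
  by rewrite !scale0r.
(* Otherwise solving for [s] exhibits it as a point of the smaller hull. *)
have ab_gt0 : 0 < a' + b' by rewrite lt_def ab0 addr_ge0.
exfalso; apply: irr.
have s_mix : s = (a' / (a' + b')) *: y' + (1 - a' / (a' + b')) *: z'.
  apply: (scalerI ab0); rewrite def_s scalerDr !scalerA.
  by congr (_ *: _ + _ *: _); field.
rewrite [X in conv_hull _ X]s_mix; case: Ty' => [a00|Ty'].
  have a'00 : a' = 0 by rewrite /a' a00 mulr0.
  rewrite a'00 mul0r scale0r add0r subr0 scale1r.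
  case: Tz' => // b00; move: ab0.
  by rewrite a'00 /b' b00 mulr0 addr0 eqxx.
case: Tz' => [b00|Tz'].
  have b'00 : b' = 0 by rewrite /b' b00 mulr0.
  move: ab0; rewrite b'00 addr0 => a'_neq0.
  by rewrite divff // subrr scale0r addr0 scale1r.
apply: conv_hull_convex => //; rewrite divr_ge0 ?addr_ge0 //=.
by rewrite ler_pdivrMr // mul1r lerDl.
Qed.

(** Discard redundant generators one at a time; once none is left, every generator is a vertex. *)
Lemma conv_hull_vertices S : exists S',
  conv_hull S' = conv_hull S /\ forall s, s \in S' -> is_vertex (conv_hull S) s.
Proof.
have [n] := ubnP (size S); elim: n S => [//|n IH] S /ltnSE leSn.
have [[s sS Ts]|irr] := pselect (exists2 s, s \in S & conv_hull (rem s S) s).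
  have eqT : conv_hull (rem s S) = conv_hull S.
    apply/seteqP; split; first by apply: conv_hull_sub => x; exact: mem_rem.
    apply: conv_hull_min; first exact: conv_hull_convex.
    move=> x; rewrite (perm_mem (perm_to_rem sS)) inE => /predU1P[->//|].
    exact: mem_conv_hull.
  rewrite -eqT; apply: IH; rewrite size_rem //.
  by case: S sS leSn {Ts eqT}.
exists S; split=> // s sS; apply: irredundant_vertex => // Ts.
by apply: irr; exists s.
Qed.

End ConvexHull.

Lemma sqdistE (R : realType) N (x y : 'rV[R]_N) :
  sqdist x y = dot (x - y) (x - y).
Proof. by apply: eq_bigr => i _; rewrite !mxE expr2. Qed.

(** * The bounded convex invariant set *)

Section InvariantSet.
Variables (R : realType) (N : nat).
Implicit Types (x q d v w : 'rV[R]_N) (D S : seq 'rV[R]_N) (b eps : R).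

(** [uniq S] keeps [size S] at most [size D], so no bound is negative when [1 <= b]. *)
Definition nested_slabs D b : set 'rV[R]_N :=
  [set x | forall S, uniq S -> {subset S <= D} ->
     dot (proj S x) (proj S x) <= b ^+ (size D).+1 - b ^+ size S].

Lemma nested_slabs0 D b : 1 <= b -> nested_slabs D b 0.
Proof.
move=> b1 S uS SD; rewrite proj0 dot0l subr_ge0 ler_weXn2l //.
by apply: leqW; exact: uniq_leq_size.
Qed.

Lemma nested_slabs_convex D b : convex_set (nested_slabs D b).
Proof.
move=> x y t Qx Qy /andP[t0 t1] S uS SD.
have := Qx S uS SD; have := Qy S uS SD.
rewrite projD !projZ; move: (proj S x) (proj S y) => {Qx}x {Qy}y.
move: (_ - _) => r hy hx.
(* The second quantity is exactly the convexity gap of the squared norm. *)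
have [t0' hxy] : 0 <= 1 - t /\ 0 <= t * (1 - t) * dot (x - y) (x - y).
  by rewrite !mulr_ge0 ?dot_ge0 // subr_ge0.
have htx := ler_wpM2l t0 hx; have hty := ler_wpM2l t0' hy.
by move: hxy; rewrite !dotE (dotC y x); lra.
Qed.

Lemma nested_slabs_norm D b x : nested_slabs D b x ->
  dot x x <= b ^+ (size D).+1 - 1.
Proof. by move=> Qx; exact: (Qx [::]). Qed.

(* [b] must beat the worst ratio between [d] and a nonzero projection of it. *)
Definition slab_ratio D b := forall S d, uniq S -> {subset S <= D} -> d \in D ->
  proj S d != 0 ->
  2 * (1 + dot d d) < dot (proj S d) (proj S d) * (b - 2).

Lemma slab_ratio_exists D : exists2 b, 1 <= b & slab_ratio D b.
Proof.
pose f S d := 2 * (1 + dot d d) / dot (proj S d) (proj S d).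
have f_ge0 S d : 0 <= f S d.
  by rewrite divr_ge0 ?mulr_ge0 ?addr_ge0 ?dot_ge0.
have [B B0 hB] := words_bounded D (size D) (fun S => \sum_(d <- D) f S d).
exists (B + 3) => [|S d uS SD dD g0]; first lra.
have gg := dot_gt0 g0.
have : f S d <= B.
  apply: le_trans (hB S (uniq_leq_size uS SD) SD).
  by rewrite (big_rem d) //= lerDl sumr_ge0.
rewrite /f ler_pdivrMr // => /le_lt_trans; apply.
by rewrite mulrC ltr_pM2l //; lra.
Qed.

(* If the constraint of [S] is almost active at [q], that of [d :: S] forces
   the component of [proj S q] along [d] to be large, while the constraint of
   [[::]] keeps [q - proj S q] small; so [dot (proj S q) d] has the sign of
   [dot q d]. *)
Lemma nested_slabs_descent D b q d S : 1 <= b -> slab_ratio D b ->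
  nested_slabs D b q -> uniq S -> {subset S <= D} -> d \in D ->
  proj S d != 0 -> dot q d <= 1 ->
  b ^+ (size D).+1 - b ^+ size S - 1 < dot (proj S q) (proj S q) ->
  dot (proj S q) d <= -1.
Proof.
move=> b1 hb Qq uS SD dD g0 qd act; rewrite leNgt; apply/negP => X_gt.
have gg := dot_gt0 g0.
set X := dot (proj S q) d in X_gt; set g2 := dot (proj S d) (proj S d) in gg.
set c := b ^+ size S; have c1 : 1 <= c by exact: exprn_ege1.
have X_large : g2 * (b * c - c - 1) <= X ^+ 2.
  have : dot (proj (d :: S) q) (proj (d :: S) q) <=
      b ^+ (size D).+1 - b ^+ size (d :: S).
    apply: Qq => [/=|e]; last by rewrite inE => /predU1P[->//|/SD].
    by rewrite uS andbT; apply: contra_neqN g0; exact: proj_mem.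
  rewrite dot_proj_cons -/X -/g2 [size (d :: S)]/= (exprS b (size S)) -/c => h.
  have : b * c - c - 1 <= X ^+ 2 / g2 by rewrite -/c in act; lra.
  by rewrite ler_pdivlMr // mulrC.
set Y := dot (q - proj S q) d.
have XY : X + Y <= 1 by rewrite /X /Y !dotE; lra.
have Y_small : Y ^+ 2 <= c * dot d d.
  apply: (le_trans (cauchy_schwarz _ _)).
  apply: ler_wpM2r; first exact: dot_ge0.
  rewrite dot_subproj; have := nested_slabs_norm Qq.
  by rewrite -/c in act; lra.
(* From [-1 < X <= 1 - Y] one gets [|X| <= 1 + |Y|]. *)
have X_small : X ^+ 2 <= 2 + 2 * Y ^+ 2.
  have := sqr_ge0 (1 + Y); have := sqr_ge0 (1 - Y); have := sqr_ge0 Y.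
  by have [X0|X0] := leP 0 X; nra.
(* As [1 <= c], [X ^+ 2] is at least [c * g2 * (b - 2)] and at most [2 * c * (1 + dot d d)], against
   the choice of [b]. *)
have gb := hb S d uS SD dD g0; rewrite -/g2 in gb.
have := dot_ge0 d; move: (dot d d) gb Y_small => d2 gb Y_small d20.
have h1 : c * (2 * (1 + d2)) < c * (g2 * (b - 2)).
  by rewrite ltr_pM2l // (lt_le_trans ltr01).
have h2 : g2 * 1 <= g2 * c by rewrite ler_pM2l.
by lra.
Qed.

Lemma nested_slabs_step D b q d eps : 1 <= b -> slab_ratio D b ->
  nested_slabs D b q -> d \in D -> 0 < eps -> dot q d <= 1 ->
  eps <= 1 -> eps * (b ^+ (size D).+1 + 2 * dot d d) <= 1 ->
  nested_slabs D b (q + eps *: d).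
Proof.
move=> b1 hb Qq dD eps0 qd eps1 epsM S uS SD.
have QS := Qq S uS SD; rewrite projD projZ.
have [->|g0] := eqVneq (proj S d) 0; first by rewrite scaler0 addr0.
have gd : dot (proj S q) (proj S d) = dot (proj S q) d.
  by rewrite -proj_sym proj_idem.
have g_le := dot_proj_le S d; have d0 := dot_ge0 d.
have A_ge0 : 0 <= b ^+ (size D).+1 by rewrite exprn_ge0 //; lra.
rewrite !dotE (dotC (proj S d)) gd.
have e2 : eps * (eps * dot (proj S d) (proj S d)) <= eps * (1 * dot d d).
  by rewrite ler_pM2l // ler_pM ?dot_ge0 // ltW.
(* With slack below 1, the cross term is at most [-2 * eps] and the quadratic one at most
   [eps / 2]. *)
have [act|slack] := ltP (b ^+ (size D).+1 - b ^+ size S - 1)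
    (dot (proj S q) (proj S q)).
  have X := nested_slabs_descent b1 hb Qq uS SD dD g0 qd act.
  have : eps * dot (proj S q) d <= eps * -1 by rewrite ler_pM2l.
  have : eps * (eps * dot (proj S d) (proj S d)) <= eps * (eps * dot d d).
    by rewrite !ler_pM2l.
  have : eps * (eps * (2 * dot d d)) <= eps * 1.
    rewrite ler_pM2l //; apply: le_trans epsM.
    by rewrite ler_pM2l //; lra.
  by lra.
(* With slack at least 1, the total change is at most [eps * (b ^+ (size D).+1 + 2 * dot d d)],
   hence at most 1. *)
have c1 : 1 <= b ^+ size S by exact: exprn_ege1.
have : eps * (2 * dot (proj S q) d) <= eps * (b ^+ (size D).+1 + dot d d).
  rewrite ler_pM2l //; have := ler_dot2 (proj S q) d.
  by lra.
by lra.
Qed.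

End InvariantSet.

(** * One set for all the polytopes, and the threshold for each *)

Theorem theorem6p2 (R : realType) (N L : nat) (P : 'I_L -> set 'rV[R]_N)
    (hP : forall j, is_polytope (P j))
    (v : 'I_L -> 'rV[R]_N -> 'rV[R]_N)
    (hv : forall j x, closest_vertex (P j) x (v j x)) :
  exists Q : set 'rV[R]_N,
    Q !=set0 /\ convex_set Q /\ bounded_set Q /\
    forall j : 'I_L, exists2 rho_j : R, 0 < rho_j &
      forall gamma rho x, P j gamma -> rho_j <= rho ->
        scale_set rho Q x -> scale_set rho Q (x + (gamma - v j x)).
Proof.
have /choice[V hV] : forall j, exists V, P j = conv_hull V /\
    forall s, s \in V -> is_vertex (P j) s.
  move=> j; have [S ->] := hP j; have [V [<- hV]] := conv_hull_vertices S.
  by exists V.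
(* Differences from all polytopes are pooled, so that the set does not depend on [j]. *)
pose D := flatten [seq [seq w - u | w <- V j, u <- V j] | j <- enum 'I_L].
have DP j w u : w \in V j -> u \in V j -> w - u \in D.
  move=> wV uV; apply/flattenP; exists [seq w - u | w <- V j, u <- V j].
    by apply: map_f; rewrite mem_enum.
  exact: allpairs_f.
have [b b1 hb] := slab_ratio_exists D.
have A_ge0 : 0 <= b ^+ (size D).+1 by rewrite exprn_ge0 //; lra.
exists (nested_slabs D b); split; first by exists 0; exact: nested_slabs0.
split; first exact: nested_slabs_convex.
split.
  exists (b ^+ (size D).+1 - 1) => x Qx.
  by rewrite sqdistE subr0; exact: nested_slabs_norm.
move=> j; have [eqP vertV] := hV j.
have [T T0 hT] := seq_bounded D (fun d => dot d d).
have [K K0 hK] := seq_bounded (V j) (fun w => dot w w).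
(* With [eps = rho^-1], the summand 1 gives [eps <= 1], the next two the last smallness condition on
   [eps], and [K] gives [dot q d <= 1]. *)
exists (1 + b ^+ (size D).+1 + 2 * T + K); first lra.
move=> gamma rho _ Pgamma le_rho [q Qq <-].
have rho0 : 0 < rho by lra.
have [vert_u u_min] := hv j (rho *: q); set u := v j _ in vert_u u_min *.
have uV : u \in V j by apply: vertex_mem; rewrite -eqP.
exists (q + rho^-1 *: (gamma - u)); last first.
  by rewrite scalerDr scalerA divff ?gt_eqF // scale1r.
move: Pgamma; rewrite eqP; move: gamma.
(* The moved point is affine in [gamma] and the set is convex, so vertices suffice. *)
apply: conv_hull_min => [x y t Ax Ay t01|w wV] /=.
  have -> : q + rho^-1 *: (t *: x + (1 - t) *: y - u) =
      t *: (q + rho^-1 *: (x - u)) + (1 - t) *: (q + rho^-1 *: (y - u)).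
    by apply/rowP => i; rewrite !mxE; ring.
  exact: nested_slabs_convex.
have dD := DP j w u wV uV; have hd := hT _ dD.
have inv0 : 0 < rho^-1 by rewrite invr_gt0.
apply: nested_slabs_step => //.
(* Expanding [|rho q - u|^2 <= |rho q - w|^2] gives [2 rho <q, w - u> <= |w|^2 - |u|^2 <= K]. *)
- have := u_min w (vertV w wV); rewrite !sqdistE !dotE !(dotC q) => h.
  have : rho * (dot w q - dot u q) <= rho * 1.
    by have := hK w wV; have := dot_ge0 u; lra.
  by rewrite ler_pM2l // !dotE.
- by rewrite invf_le1 //; lra.
- by rewrite mulrC ler_pdivrMr // mul1r; lra.
Qed.
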